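(* Let $m$ be a positive integer and let $a_1,a_2,K$ be integers with $0\le a_1,a_2,K\le m-1$. Then $$0\le S_m(\{a_1,a_2\},K).$$
   Context: For a positive integer $m$ and non-negative integers $a_1,a_2,K$ (with $a_1=a_2$ allowed; $\{a_1,a_2\}$ is just a list of parameters), define $$S_m(\{a_1,a_2\},K)=\sum_{k=0}^K\left(\left\lfloor\frac{a_1+a_2+k}{m}\right\rfloor-\left\lfloor\frac{a_1+k}{m}\right\rfloor-\left\lfloor\frac{a_2+k}{m}\right\rfloor+\left\lfloor\frac{k}{m}\right\rfloor\right).$$ *)

(* Defs.v *)
From mathcomp Require Import all_boot all_order all_algebra.
Set Implicit Arguments.
Unset Strict Implicit.
Unset Printing Implicit Defensive.
Import Order.TTheory GRing.Theory Num.Theory.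
Local Open Scope ring_scope.

(* For natural numbers the floor of a quotient is [%/]; each floor is cast to
   [int] before being combined, so that the subtractions are not truncated. *)
Definition floorS (m a1 a2 K : nat) : int :=
  \sum_(k < K.+1)
    (((a1 + a2 + k) %/ m)%N%:Z - ((a1 + k) %/ m)%N%:Z
     - ((a2 + k) %/ m)%N%:Z + (k %/ m)%N%:Z).

(* Main.v *)
Require Import Defs.
From mathcomp Require Import all_boot all_order all_algebra.
From mathcomp Require Import zify.
Import Order.TTheory GRing.Theory Num.Theory.
Local Open Scope ring_scope.

(** For [x < 3m] the floor of [x/m] is [[m <= x] + [2m <= x]], so with
    [N = K + 1 <= m] and [f t = max (N - t) 0], the sum over [k < N] of the floor
    of [(s + k)/m] is [f (max (m - s) 0) + f (2m - s)] whenever [s < 2m].  With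
    [x = m - a1], [y = m - a2], the claim becomes
    [f x + f y <= f (max (x + y - m) 0) + f (x + y)]. *)

Lemma divn_lt3 (m x : nat) : (x < 3 * m)%N ->
  (x %/ m = (m <= x) + (2 * m <= x))%N.
Proof.
move=> hx; have m_gt0 : (0 < m)%N by lia.
have := divn_eq x m; have := ltn_pmod x m_gt0.
have : (x %/ m < 3)%N by rewrite ltn_divLR.
by case: (x %/ m)%N => [|[|[|//]]] _; lia.
Qed.

(* Both subtractions are truncated, which is what encodes the maxima with 0. *)
Lemma sum_divn_shift (m s n : nat) : (s < 2 * m)%N -> (n <= m)%N ->
  (\sum_(k < n) (s + k) %/ m = (n - (m - s)) + (n - (2 * m - s)))%N.
Proof.
move=> hs; elim: n => [|n IHn] hn; first by rewrite big_ord0.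
rewrite big_ord_recr /= IHn; last exact: ltnW.
(* As [n < m], the new term has [s + n < 3 * m]; the two truncated differences grow by one exactly
   when [m <= s + n] and [2 * m <= s + n]. *)
by rewrite divn_lt3; lia.
Qed.

Theorem theorem9 (m a1 a2 K : nat) (hm : (0 < m)%N)
  (ha1 : (a1 <= m - 1)%N) (ha2 : (a2 <= m - 1)%N) (hK : (K <= m - 1)%N) :
  0 <= floorS m a1 a2 K.
Proof.
(* The second difference truncates to 0, since [K.+1 <= m < 2 * m - a]. *)
have sum_shift_lt a : (a <= m - 1)%N ->
    (\sum_(k < K.+1) (a + k) %/ m = K.+1 - (m - a))%N.
  by move=> ha; rewrite sum_divn_shift; lia.
rewrite /floorS big_split !sumrB /= -!(big_morph Posz PoszD (erefl _)).
rewrite (sum_shift_lt _ ha1) (sum_shift_lt _ ha2) (sum_divn_shift m); [|lia..].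
(* The inequality left to [lia] is convexity of [f]: compare [x], [y] with the wider pair 0, [x + y]
   if [x + y <= m], else with [x + y - m], [m], where [f m = f (x + y) = 0]. *)
rewrite [X in _ + Posz X]big1 => [|k _]; first lia.
by rewrite divn_small //; have := ltn_ord k; lia.
Qed.
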